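(* Let $p$ be an even positive integer. Then there exists a unique (up to isomorphism) graph of order $p+2$ and size $\mathrm{ex}(p+2,B_p)+1$ which contains exactly one copy of $B_p$, and there exists a unique (up to isomorphism) graph of order $p+3$ and size $\mathrm{ex}(p+3,B_p)+1$ which contains exactly one copy of $B_p$.
   Context: All graphs are finite and simple. The order of a graph is its number of vertices and its size is its number of edges. A copy of $H$ in $G$ is a subgraph of $G$ isomorphic to $H$; the number of copies of $H$ in $G$ is the number of distinct subgraphs of $G$ isomorphic to $H$. For a graph $H$ and a positive integer $n$, the Turán number $\mathrm{ex}(n,H)$ is the maximum size of a simple graph of order $n$ containing no copy of $H$. The book $B_p$ with $p$ pages is the graph consisting of $p$ triangles sharing a common edge (so $B_p$ has $p+2$ vertices and $2p+1$ edges). *)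

(* Defs.v *)
From mathcomp Require Import all_boot.
Set Implicit Arguments. Unset Strict Implicit. Unset Printing Implicit Defensive.

Definition simple_graph (T : finType) (E : {set {set T}}) : bool :=
  [forall e in E, #|e| == 2].

(* The copies of H (edge set EH on vertex type U) in G (edge set EG on T):
   the set of distinct subgraphs (S, F) of G (S a vertex set, F an edge set,
   F \subset EG) which are isomorphic to H, i.e. images of H under some
   injective vertex map f : U -> T. *)
Definition copies (U T : finType) (EH : {set {set U}}) (EG : {set {set T}})
  : {set ({set T} * {set {set T}})} :=
  [set SF : {set T} * {set {set T}} | (SF.2 \subset EG) &&
     [exists f : {ffun U -> T},
        [&& injectiveb f, SF.1 == f @: [set: U] & SF.2 == [set f @: e | e : {set U} in EH]]]].

Definition num_copies (U T : finType) (EH : {set {set U}}) (EG : {set {set T}}) : nat :=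
  #|copies EH EG|.

Definition ex (n : nat) (U : finType) (EH : {set {set U}}) : nat :=
  \max_(E : {set {set 'I_n}} | simple_graph E && (num_copies EH E == 0)) #|E|.

Definition isomorphic (n : nat) (E1 E2 : {set {set 'I_n}}) : Prop :=
  exists f : {ffun 'I_n -> 'I_n}, injectiveb f /\ [set f @: e | e : {set 'I_n} in E1] = E2.

(* The book B_p: vertices 0,1 (the spine) and 2..p+1 (pages); edges are all
   2-subsets containing 0 or 1, i.e. 01 and 0i, 1i for i >= 2. *)
Definition book (p : nat) : {set {set 'I_p.+2}} :=
  [set e : {set 'I_p.+2} | (#|e| == 2) && ((ord0 \in e) || (inord 1 \in e))].

Definition unique_graph_one_copy (n m : nat) (U : finType) (EH : {set {set U}}) : Prop :=
  exists E : {set {set 'I_n}},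
    [/\ simple_graph E, #|E| = m, num_copies EH E = 1 &
      forall E' : {set {set 'I_n}},
        simple_graph E' -> #|E'| = m -> num_copies EH E' = 1 -> isomorphic E E'].

(* Main.v *)
(* Pass to the complement: a copy of B_p with spine uv and vertex set S exists iff
   u and v have no non-neighbour in S. On p + 2 vertices a copy is thus a pair of
   isolated vertices of the complement; on p + 3 vertices it is a non-adjacent pair
   of the complement whose neighbourhoods have at most one vertex w in total, S
   missing just w (any vertex can be missed when both are isolated). Degree sums
   plus parity give the minimum size of the complement of a B_p-free graph: a
   perfect matching, resp. a triangle plus a matching. With one edge less, having
   a single copy forces two isolated vertices plus a matching, resp. a path on
   three vertices plus a matching. *)
Require Import Defs.
From mathcomp Require Import all_boot.
From mathcomp Require Import zify.
Set Implicit Arguments. Unset Strict Implicit. Unset Printing Implicit Defensive.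

(** A single term above one would push the sum past [#|A|]. This turns a tight bound on a degree sum
    into exact degrees. *)
Lemma sum_eq_card_eq1 (T : finType) (A : {set T}) (F : T -> nat) :
  (forall x, x \in A -> 0 < F x) -> \sum_(x in A) F x <= #|A| ->
  forall x, x \in A -> F x = 1.
Proof.
move=> F_gt0 leA x Ax; apply/eqP; rewrite eqn_leq F_gt0 // andbT.
rewrite leqNgt; apply: contraL leA => Fx; rewrite -ltnNge.
rewrite (bigD1 x) //= (cardsD1 x) Ax -[#|_ :\ _|]sum1_card.
rewrite (eq_bigl (fun y => (y \in A) && (y != x))) => [|y]; last first.
  by rewrite !inE andbC.
by rewrite -addSn leq_add // leq_sum // => y /andP[/F_gt0].
Qed.

(** * Degrees in the complement and their sum *)

Section Nonneighbours.
Variables (T : finType).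
Implicit Types (E : {set {set T}}) (u v w x y : T) (S : {set T}).

(** This is the neighbourhood of [u] in the complement of [E]. The vertex [u] must be excluded by
    hand, since [[set u; u]] is a singleton and never an edge of a simple graph. *)
Definition nonnbrs E u : {set T} := [set w | (w != u) && ([set u; w] \notin E)].

Lemma in_nonnbrs E u w :
  (w \in nonnbrs E u) = (w != u) && ([set u; w] \notin E).
Proof. by rewrite inE. Qed.

Lemma nonnbrs_sym E u w : (w \in nonnbrs E u) = (u \in nonnbrs E w).
Proof. by rewrite !in_nonnbrs eq_sym setUC. Qed.

Lemma simple_neq E u w : simple_graph E -> [set u; w] \in E -> w != u.
Proof.
by move=> /forall_inP sE /sE; rewrite cards2 [w == u]eq_sym; case: (u == w).
Qed.

(** Double counting of incident vertex-edge pairs: [w] mapped to [[set u; w]] is a bijection from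
    the neighbours of [u] to the edges at [u]. *)
Lemma sum_deg E : simple_graph E ->
  \sum_u #|[set w | [set u; w] \in E]| = 2 * #|E|.
Proof.
move=> sE; transitivity (\sum_u \sum_(e in E) (u \in e : nat)).
  apply: eq_bigr => u _.
  rewrite -(@card_in_imset _ _ (fun w => [set u; w])); last first.
    move=> w w'; rewrite !inE => /(simple_neq sE) wu /(simple_neq sE) w'u eqw.
    have : w \in [set u; w'] by rewrite -eqw set22.
    by rewrite !inE (negPf wu) => /eqP.
  rewrite -big_mkcondr sum1dep_card; apply: eq_card => e; rewrite inE.
  apply/imsetP/andP => [[w]|[eE ue]]; first by rewrite inE => ? ->; rewrite set21.
  have /cards2P[x [y [xy def_e]]] := forall_inP sE _ eE.
  move: ue eE; rewrite def_e !inE => /orP[] /eqP-> eE.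
    by exists y; rewrite ?inE.
  by exists x; rewrite ?inE 1?setUC.
rewrite exchange_big /= (eq_bigr (fun=> 2)); first by rewrite sum_nat_const mulnC.
move=> e eE; rewrite -(eqP (forall_inP sE _ eE)).
by rewrite -sum1_card [RHS]big_mkcond; apply: eq_bigr => u _; case: (u \in e).
Qed.

(** Neighbours and nonneighbours of [u] partition the other vertices. Hence, at fixed order,
    maximising the size means minimising the sum of complement degrees. *)
Lemma sum_nonnbrs E : simple_graph E ->
  \sum_u #|nonnbrs E u| + 2 * #|E| = #|T| * #|T|.-1.
Proof.
move=> sE; rewrite -sum_deg // -big_split /= -sum_nat_const.
apply: eq_bigr => u _.
set N := [set w | _]; rewrite -cardsUI.
have -> : nonnbrs E u :|: N = [set~ u].
  apply/setP => w; rewrite !inE; case: eqP => [->|] /=; last by rewrite orNb.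
  by apply/negP => /(simple_neq sE); rewrite eqxx.
have -> : nonnbrs E u :&: N = set0.
  by apply/setP => w; rewrite !inE -andbA andNb andbF.
by rewrite cards0 addn0 cardsC1.
Qed.

Lemma sum_nonnbrs_succ E E1 : simple_graph E -> simple_graph E1 ->
  #|E1| = #|E|.+1 -> \sum_u #|nonnbrs E u| = \sum_u #|nonnbrs E1 u| + 2.
Proof. by move=> /sum_nonnbrs + /sum_nonnbrs + eqE; rewrite eqE; lia. Qed.

(** The sum differs by an even number from a product of consecutive integers. This is the parity
    argument that sharpens both lower bounds. *)
Lemma odd_sum_nonnbrs E : simple_graph E -> odd (\sum_u #|nonnbrs E u|) = false.
Proof.
move/sum_nonnbrs/(congr1 odd); rewrite oddD [in X in _ (+) X]oddM /= addbF => ->.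
by rewrite oddM; case: #|T| => //= n; rewrite andNb.
Qed.

(** * Copies of the book described by a spine and a vertex set *)

Section Books.
Variable p : nat.

(** The pair has the type of a member of [copies]. It is a book with spine [u v] only under the side
    conditions of [has_book]. *)
Definition book_on u v S : {set T} * {set {set T}} :=
  (S, [set e : {set T} | [&& #|e| == 2, e \subset S & (u \in e) || (v \in e)]]).

(** The last condition encodes that the edges of the book lie in [E]: each of [u] and [v] is
    adjacent to every other vertex of [S]. *)
Definition has_book E u v S : Prop :=
  [/\ u != v, u \in S, v \in S, #|S| = p.+2 &
      S \subset ~: (nonnbrs E u :|: nonnbrs E v)].

Lemma book_onC u v S : book_on u v S = book_on v u S.
Proof. by congr pair; apply/setP => e; rewrite !inE [(u \in e) || _]orbC. Qed.

Lemma copy_has_book E SF : SF \in copies (book p) E ->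
  exists u v S, has_book E u v S /\ SF = book_on u v S.
Proof.
rewrite inE => /andP[FE /existsP[f /and3P[/injectiveP f_inj /eqP S1 /eqP F1]]].
have n01 : ord0 != inord 1 :> 'I_p.+2 by rewrite -val_eqE /= inordK.
pose S := f @: [set: 'I_p.+2].
have fS i : f i \in S by apply: imset_f.
have defF : SF.2 = (book_on (f ord0) (f (inord 1)) S).2.
  rewrite F1; apply/setP => e; rewrite [RHS]inE; apply/imsetP/and3P.
    move=> [e']; rewrite inE => /andP[ce' in_e'] ->; split.
    - by rewrite card_imset.
    - by apply: imsetS; apply: subsetT.
    - by rewrite !mem_imset.
  move=> [ce eS in_e].
  have def_e : e = f @: (f @^-1: e).
    apply/setP => x; apply/idP/imsetP => [xe|[i]]; last by rewrite inE => ? ->.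
    by have /imsetP[i _ def_x] := subsetP eS _ xe; exists i; rewrite // inE -def_x.
  exists (f @^-1: e) => //.
  by rewrite inE -(card_imset _ f_inj) -def_e ce !inE in_e.
exists (f ord0), (f (inord 1)), S; split; last first.
  by rewrite [SF]surjective_pairing defF S1.
split=> //; first by rewrite (inj_eq f_inj).
  by rewrite card_imset // cardsT card_ord.
(* The copy joins [x] to every spine vertex other than [x], and its edges lie in [E]. *)
apply/subsetP => x xS; rewrite !inE !negb_or !negb_and !negbK.
by apply/andP; split; case: (eqVneq x) => //= ne; apply: (subsetP FE);
  rewrite defF !inE cards2 [_ == x]eq_sym ne subUset !sub1set fS xS /= ?eqxx ?orbT.
Qed.

Lemma has_book_copy E u v S :
  has_book E u v S -> book_on u v S \in copies (book p) E.
Proof.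
case=> uv uS vS cS /subsetP SM.
(* The spine is listed first, so that indexing by [s] sends the model spine [ord0], [inord 1] to
   [u], [v]. *)
pose s := u :: v :: enum (S :\ u :\ v).
have size_s : size s = p.+2.
  have := cS; rewrite (cardsD1 u) uS (cardsD1 v) !inE eq_sym uv vS /= -cardE.
  by rewrite !add1n.
have s_uniq : uniq s.
  by rewrite /= enum_uniq !inE !mem_enum !inE !eqxx (negPf uv) ?andbF.
have mem_s x : (x \in s) = (x \in S).
  rewrite !inE mem_enum !inE; have [->|_] := eqVneq x u; first by rewrite uS.
  by have [->|_] := eqVneq x v; first by rewrite vS.
rewrite inE; apply/andP; split.
  apply/subsetP => e; rewrite inE => /and3P[/cards2P[x [y [xy ->]]] eS uve].
  have [xS yS] : x \in S /\ y \in S by split; apply: (subsetP eS); rewrite !inE eqxx ?orbT.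
  have := SM _ xS; have := SM _ yS; rewrite !inE !negb_or !negb_and !negbK.
  move=> /andP[yu yv] /andP[xu xv].
  move: uve; rewrite !inE -orbA => /or4P[] /eqP ?; subst.
  - by move: yu; rewrite eq_sym (negPf xy).
  - by move: xu; rewrite (negPf xy) /= setUC.
  - by move: yv; rewrite eq_sym (negPf xy).
  - by move: xv; rewrite (negPf xy) /= setUC.
pose f := [ffun i : 'I_p.+2 => nth u s i].
have f_inj : injective f.
  move=> i j; rewrite !ffunE => /eqP; rewrite nth_uniq ?size_s //.
  by move/eqP/val_inj.
have f0 : f ord0 = u by rewrite ffunE.
have f1 : f (inord 1) = v by rewrite ffunE inordK.
have fS : f @: [set: 'I_p.+2] = S.
  apply/setP => x; rewrite -mem_s; apply/imsetP/idP => [[i _ ->]|xs].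
    by rewrite ffunE mem_nth ?size_s.
  have ltx : index x s < p.+2 by rewrite -size_s index_mem.
  by exists (Ordinal ltx); rewrite ?inE // ffunE nth_index.
apply/existsP; exists f; apply/and3P; split; first exact/injectiveP.
  by rewrite fS.
apply/eqP/setP => e; rewrite [LHS]inE; apply/and3P/imsetP.
  move=> [ce eS in_e].
  have def_e : e = f @: (f @^-1: e).
    apply/setP => x; apply/idP/imsetP => [xe|[i]]; last by rewrite inE => ? ->.
    have := subsetP eS _ xe; rewrite -fS => /imsetP[i _ def_x].
    by exists i; rewrite // inE -def_x.
  exists (f @^-1: e) => //.
  by rewrite inE -(card_imset _ f_inj) -def_e ce [in X in X || _]inE [in X in _ || X]inE f0 f1.
move=> [e']; rewrite inE => /andP[ce' in_e'] ->; split.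
- by rewrite card_imset.
- by rewrite -fS; apply: imsetS; apply: subsetT.
- by rewrite -f0 -f1 !mem_imset.
Qed.

Lemma book_free_no_book E u v S :
  num_copies (book p) E = 0 -> ~ has_book E u v S.
Proof.
by move=> /eqP; rewrite cards_eq0 => /eqP c0 /has_book_copy; rewrite c0 inE.
Qed.

Lemma no_book_book_free E :
  (forall u v S, ~ has_book E u v S) -> num_copies (book p) E = 0.
Proof.
move=> no; apply/eqP; rewrite cards_eq0; apply/eqP/setP => SF; rewrite in_set0.
by apply/negP => /copy_has_book[u [v [S [/no]]]].
Qed.

Hypothesis p_gt1 : 1 < p.

(** With at least two pages the spine can be read off the edges. If [v] were outside the other
    spine, some [d] in [S] would differ from [v], [u'] and [v'], as [S] has at least four elements;
    the edge [v d] is then in the first book but not in the second. For one page this fails, the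
    book being a triangle. *)
Lemma book_on_inj u v S u' v' S' : #|S| = p.+2 -> v \in S ->
  book_on u v S = book_on u' v' S' -> S = S' /\ v \in [set u'; v'].
Proof.
move=> cS vS [eqS eqF]; split=> //; apply/negPn/negP => v_notin.
have /subsetPn[d dS] : ~~ (S \subset [set v; u'; v']).
  apply: contraL (p_gt1) => /subset_leq_card; rewrite cS -leqNgt => le.
  have := cardsU [set v; u'] [set v']; rewrite !cards2 cards1; lia.
rewrite !inE !negb_or => /andP[/andP[dv du'] dv'].
have /setP/(_ [set v; d]) := eqF.
rewrite !inE cards2 (eq_sym v d) dv subUset !sub1set vS dS eqxx orbT /=.
move: v_notin; rewrite !inE !negb_or => /andP[vu' vv'].
by rewrite ![_ == v]eq_sym ![_ == d]eq_sym (negPf vu') (negPf vv') (negPf du') (negPf dv') andbF.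
Qed.

Lemma one_copy_has_book E : num_copies (book p) E = 1 ->
  exists u v S, has_book E u v S.
Proof.
move=> /eqP/cards1P[SF def]; have : SF \in copies (book p) E by rewrite def set11.
by case/copy_has_book=> u [v [S []]]; exists u, v, S.
Qed.

Lemma one_copy_uniq E u v S u' v' S' : num_copies (book p) E = 1 ->
  has_book E u v S -> has_book E u' v' S' -> S = S' /\ v \in [set u'; v'].
Proof.
move=> /eqP/cards1P[SF def] b b'; have [_ _ vS cS _] := b.
apply: (book_on_inj (u := u) cS vS); move: (has_book_copy b) (has_book_copy b').
by rewrite def !in_set1 => /eqP-> /eqP->.
Qed.

(** Exchanging the ends of a spine gives the same subgraph, so the spine need be unique only up to
    order. *)
Lemma one_copyI E u v S : has_book E u v S ->
  (forall u' v' S', has_book E u' v' S' ->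
     S' = S /\ ((u' = u /\ v' = v) \/ (u' = v /\ v' = u))) ->
  num_copies (book p) E = 1.
Proof.
move=> b uniq_b; apply/eqP/cards1P; exists (book_on u v S); apply/setP => SF.
rewrite in_set1; apply/idP/eqP => [|->]; last exact: has_book_copy.
case/copy_has_book=> u' [v' [S' [/uniq_b[-> [[-> ->]|[-> ->]]] ->]]] //.
exact: book_onC.
Qed.

End Books.
End Nonneighbours.

(** * Building isomorphisms along perfect matchings of the complement *)

(** The fixed-point-free involutions [m] and [m'] encode perfect matchings on [A] and [A'].
    Induction on [#|A|] sends one matched pair to one matched pair at a time; the values of [f] on
    [A] are overwritten. *)
Lemma matching_extension (T T' : finType) (A : {set T}) (A' : {set T'})
    (m : T -> T) (m' : T' -> T') (f : T -> T') :
  #|A| = #|A'| ->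
  (forall x, x \in A -> [/\ m x \in A, m x != x & m (m x) = x]) ->
  (forall x, x \in A' -> [/\ m' x \in A', m' x != x & m' (m' x) = x]) ->
  {in ~: A &, injective f} -> (forall x, x \notin A -> f x \notin A') ->
  exists g : T -> T', [/\ injective g, {in ~: A, g =1 f} &
    forall x, x \in A -> g x \in A' /\ g (m x) = m' (g x)].
Proof.
have [k] := ubnP #|A|; elim: k => // k IHk in A A' f * => ltAk eqA mA mA' f_inj fA.
have [A0|/set0Pn[a aA]] := eqVneq A set0.
  by exists f; split=> // [x y|x]; [apply: f_inj|]; rewrite A0 inE ?inE.
have /set0Pn[a' aA'] : A' != set0.
  by rewrite -card_gt0 -eqA card_gt0; apply/set0Pn; exists a.
have [maA ma mma] := mA _ aA; have [maA' ma' mma'] := mA' _ aA'.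
(* The chosen pair [a], [m a] goes to [a'], [m' a']. Both pairs then leave the sets, and [f1] serves
   as the prescribed map for the induction hypothesis. *)
pose f1 x := if x == a then a' else if x == m a then m' a' else f x.
have [||||||g [g_inj gf gm]] := IHk (A :\ a :\ m a) (A' :\ a' :\ m' a') f1.
- by move: ltAk; rewrite (cardsD1 a) aA (cardsD1 (m a)) !inE ma maA; lia.
- move: eqA; rewrite (cardsD1 a) aA (cardsD1 (m a)) !inE ma maA.
  by rewrite (cardsD1 a' A') aA' (cardsD1 (m' a') (_ :\ _)) !inE ma' maA'; lia.
- move=> x; rewrite !inE => /and3P[x_ma x_a /mA[mxA mx mmx]]; split=> //.
  rewrite mxA andbT; apply/andP; split.
    by apply: contraNneq x_a => eqm; rewrite -mmx eqm mma.
  by apply: contraNneq x_ma => eqm; rewrite -mmx eqm.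
- move=> x; rewrite !inE => /and3P[x_ma x_a /mA'[mxA mx mmx]]; split=> //.
  rewrite mxA andbT; apply/andP; split.
    by apply: contraNneq x_a => eqm; rewrite -mmx eqm mma'.
  by apply: contraNneq x_ma => eqm; rewrite -mmx eqm.
- have f1A z : z \notin A :\ a :\ m a -> z != a -> z != m a -> z \notin A /\ f z \notin A'.
    by rewrite !inE => zA za zma; move: zA; rewrite za zma /= => zA; split=> //; apply: fA.
  move=> x y; rewrite ![_ \in ~: _]inE => /f1A Hx /f1A Hy; rewrite /f1.
  have [->|xa] := eqVneq x a; have [->|ya] := eqVneq y a => //.
  + have [-> /eqP|yma] := eqVneq y (m a); first by rewrite eq_sym (negPf ma').
    by have [_ /[swap] <-] := Hy ya yma; rewrite aA'.
  + have [-> /eqP|xma] := eqVneq x (m a); first by rewrite (negPf ma').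
    by have [_ /[swap] ->] := Hx xa xma; rewrite aA'.
  have [->|xma] := eqVneq x (m a); have [->|yma] := eqVneq y (m a) => //.
  + by have [_ /[swap] <-] := Hy ya yma; rewrite maA'.
  + by have [_ /[swap] ->] := Hx xa xma; rewrite maA'.
  have [xA _] := Hx xa xma; have [yA _] := Hy ya yma.
  by apply: f_inj; rewrite inE.
- move=> x xA; rewrite /f1 !inE.
  have [|xa] := eqVneq x a; first by rewrite eqxx andbF.
  have [|xma] := eqVneq x (m a); first by rewrite eqxx.
  by move: xA; rewrite !inE xa xma /= => /fA/negPf->; rewrite !andbF.
have ga : g a = a' by rewrite gf /f1 ?eqxx // !inE eqxx andbF.
have gma : g (m a) = m' a' by rewrite gf /f1 ?eqxx ?(negPf ma) // !inE eqxx.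
exists g; split=> // x.
  rewrite inE => xA; rewrite gf; last by rewrite !inE (negPf xA) !andbF.
  by rewrite /f1; do 2![case: eqP => [def_x|_]; first by rewrite def_x ?aA ?maA in xA].
move=> xA; have [->|xa] := eqVneq x a; first by rewrite gma ga.
have [->|xma] := eqVneq x (m a); first by rewrite gma mma ga mma'.
by have [] := gm x; rewrite !inE ?xa ?xma // => /and3P[].
Qed.

(** The lists [s] and [s'] hold the exceptional vertices, matched by position; elsewhere both
    complements are perfect matchings. Only one direction of nonadjacency is required on the lists,
    because equal sizes turn an inclusion of edge sets into an equality. *)
Lemma isomorphic_matched (n : nat) (E E' : {set {set 'I_n}}) (s s' : seq 'I_n) :
  simple_graph E -> #|E| = #|E'| -> uniq s -> uniq s' -> size s = size s' ->
  (forall x0 i j, i < size s -> j < size s ->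
     nth x0 s' j \in nonnbrs E' (nth x0 s' i) ->
     nth x0 s j \in nonnbrs E (nth x0 s i)) ->
  (forall x, x \notin s -> exists2 y, y \notin s & nonnbrs E x = [set y]) ->
  (forall x, x \notin s' -> exists2 y, y \notin s' & nonnbrs E' x = [set y]) ->
  isomorphic E E'.
Proof.
move=> sE cE us us' size_s ss' matched matched'.
(* The default [x] is never reached off the list, where the nonneighbour set is a singleton. *)
pose partner D x := odflt x [pick y in nonnbrs (T := 'I_n) D x].
have partnerP (D : {set {set 'I_n}}) (t : seq 'I_n) :
    (forall x, x \notin t -> exists2 y, y \notin t & nonnbrs D x = [set y]) ->
  forall x, x \notin t -> partner D x \notin t /\ nonnbrs D x = [set partner D x].
  move=> tD x /tD[y yt Dx]; rewrite /partner Dx; case: pickP => [z|/(_ y)].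
    by rewrite inE => /eqP->.
  by rewrite set11.
have mP (D : {set {set 'I_n}}) (t : seq 'I_n) :
    (forall x, x \notin t -> exists2 y, y \notin t & nonnbrs D x = [set y]) ->
  forall x, x \in [set y | y \notin t] -> [/\ partner D x \in [set y | y \notin t],
    partner D x != x & partner D (partner D x) = x].
  move=> tD x; rewrite inE => xt; have [mt Dx] := partnerP _ _ tD _ xt.
  have : partner D x \in nonnbrs D x by rewrite Dx set11.
  move=> mD; split; first by rewrite inE.
    by move: mD; rewrite in_nonnbrs => /andP[].
  have [_ Dmx] := partnerP _ _ tD _ mt.
  by move: mD; rewrite nonnbrs_sym Dmx => /set1P.
have cs (t : seq 'I_n) : uniq t -> #|[set x | x \notin t]| = n - size t.
  move=> ut; have := cardC [in t]; rewrite (card_uniqP ut) card_ord cardsE.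
  by move/(canRL (addKn _)) => <-; apply: eq_card.
have [|||||g [g_inj gf gm]] := @matching_extension _ _
    [set x | x \notin s] [set x | x \notin s'] (partner E) (partner E')
    (fun x => nth x s' (index x s)).
- by rewrite !cs // size_s.
- exact: mP.
- exact: mP.
- move=> x y; rewrite !inE !negbK => xs ys; rewrite (set_nth_default y) -?size_s ?index_mem //.
  move/eqP; rewrite nth_uniq -?size_s ?index_mem // => /eqP eq_i.
  by rewrite -(nth_index x xs) eq_i nth_index.
- by move=> x; rewrite !inE !negbK => xs; rewrite mem_nth // -size_s index_mem.
have gs x : (g x \in s') = (x \in s).
  have [xs|xs] := boolP (x \in s).
    by rewrite gf ?inE ?negbK ?mem_nth // -size_s index_mem.
  by have [] := gm x; rewrite !inE // => /negPf.
(* No complement edge leaves [s']: the only nonneighbour of an outside vertex is itself outside. *)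
have in_s' x y : x \in s' -> y \in nonnbrs E' x -> y \in s'.
  move=> xs' yx; apply: contraTT xs' => /(partnerP _ _ matched')[+ E'y].
  by move: yx; rewrite nonnbrs_sym E'y inE => /eqP->.
have nonE x y : g y \in nonnbrs E' (g x) -> y \in nonnbrs E x.
  have [xs|xs] := boolP (x \in s).
    move=> gyx; have ys : y \in s by rewrite -gs (in_s' (g x)) ?gs.
    have gE z : z \in s -> g z = nth x s' (index z s).
      move=> zs; rewrite gf ?inE ?negbK //.
      by apply: set_nth_default; rewrite -size_s index_mem.
    move: gyx; rewrite !gE //.
    by move/ss'; rewrite !index_mem !nth_index //; apply.
  have [|gxA' gmx] := gm x; first by rewrite inE.
  rewrite inE in gxA'.
  have [_ ->] := partnerP _ _ matched' _ gxA'.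
  have [_ ->] := partnerP _ _ matched _ xs.
  by rewrite -gmx !inE (inj_eq g_inj).
exists (finfun g); split.
  by apply/injectiveP => x y; rewrite !ffunE; apply: g_inj.
apply/eqP; rewrite eqEcard card_imset -?cE ?leqnn ?andbT; last first.
  by apply: imset_inj => x y; rewrite !ffunE; apply: g_inj.
apply/subsetP => _ /imsetP[e eE ->].
have /cards2P[x [y [xy def_e]]] := forall_inP sE _ eE.
rewrite def_e imsetU1 imset_set1 !ffunE; apply: contraLR eE => gE.
have : y \in nonnbrs E x by rewrite nonE // in_nonnbrs (inj_eq g_inj) eq_sym xy.
by rewrite in_nonnbrs def_e => /andP[].
Qed.

(** * Complement degrees at order p + 2 *)

Section OrderPlusTwo.
Variables (p : nat) (p_gt1 : 1 < p).
Variables (T : finType) (cardT : #|T| = p.+2).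
Implicit Type E : {set {set T}}.

Lemma has_book_order2 E u v S :
  has_book p E u v S <->
  [/\ u != v, S = setT, nonnbrs E u = set0 & nonnbrs E v = set0].
Proof.
split=> [[uv _ _ cS SM]|[uv -> Mu Mv]]; last first.
  by rewrite /has_book !inE cardsT cardT Mu Mv setU0 setC0 subxx.
have def_S : S = setT by apply/eqP; rewrite eqEcard subsetT cardsT cardT cS leqnn.
move: SM; rewrite def_S setCU subsetI -!setC0 !setCS !subset0.
by case/andP => /eqP-> /eqP->.
Qed.

(** Two vertices isolated in the complement would span a book. So at most one is isolated and the
    sum is at least p + 1, which is odd; parity adds one more. *)
Lemma book_free_sum_order2 E : ~~ odd p -> simple_graph E ->
  num_copies (book p) E = 0 -> p.+2 <= \sum_u #|nonnbrs E u|.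
Proof.
move=> p_even sE free; rewrite leqNgt; apply/negP => lt.
have : \sum_u #|nonnbrs E u| < p.+1.
  rewrite ltn_neqAle -ltnS lt andbT; apply/eqP => eq_sum.
  by have := odd_sum_nonnbrs sE; rewrite eq_sum /= p_even.
have [/existsP[u /eqP Mu]|noM] := boolP [exists u, nonnbrs E u == set0]; last first.
  apply/negP; rewrite -leqNgt -ltnS -cardT -sum1_card leqW // leq_sum // => u _.
  by rewrite card_gt0; move/existsPn: noM.
apply/negP; rewrite -leqNgt (bigD1 u) //= Mu cards0 add0n.
have <- : #|[set~ u]| = p.+1 by rewrite cardsC1 cardT.
rewrite -sum1_card (eq_bigl (fun v => v != u)) => [|v]; last by rewrite !inE.
apply: leq_sum => v vu; rewrite card_gt0; apply/negP => /eqP Mv.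
apply: (book_free_no_book (u := u) (v := v) (S := setT) free).
by apply/has_book_order2; rewrite eq_sym.
Qed.

(** The spine [a b] of the only copy is isolated in the complement. A third isolated vertex [y]
    would give another spine [a y], so the remaining p vertices have positive complement degrees
    with sum at most p: all equal one. *)
Lemma one_copy_order2 E : \sum_u #|nonnbrs E u| = p ->
  num_copies (book p) E = 1 ->
  exists a b, [/\ a != b, nonnbrs E a = set0, nonnbrs E b = set0 &
    forall x, x \notin [:: a; b] ->
      exists2 y, y \notin [:: a; b] & nonnbrs E x = [set y]].
Proof.
move=> sumE one; have [a [b [S bk]]] := one_copy_has_book one.
have [ab def_S Ma Mb] := (has_book_order2 _ _ _ _).1 bk.
exists a, b; split=> // x xab.
have cardA : #|~: [set a; b]| = p.
  by have := cardsC [set a; b]; rewrite cards2 ab cardT add2n => -[].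
have Mgt0 y : y \in ~: [set a; b] -> 0 < #|nonnbrs E y|.
  rewrite !inE negb_or => /andP[ya yb]; rewrite card_gt0.
  apply/negP => /eqP My; have := one_copy_uniq p_gt1 one (u' := a) (v' := y) (S' := S).
  move=> /(_ _ _ _ bk)[]; first by apply/has_book_order2; rewrite eq_sym.
  by rewrite !inE [b == a]eq_sym (negPf ab) eq_sym (negPf yb).
have /eqP/cards1P[y Mx] : #|nonnbrs E x| = 1.
  apply: (sum_eq_card_eq1 Mgt0); last by rewrite !inE in xab *.
  rewrite cardA -sumE [leqRHS](bigID (mem (~: [set a; b]))) /=.
  exact: leq_addr.
have xy : x \in nonnbrs E y by rewrite nonnbrs_sym Mx set11.
exists y => //; rewrite !inE negb_or; apply/andP.
by split; apply: contraTneq xy => ->; rewrite ?Ma ?Mb inE.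
Qed.

End OrderPlusTwo.

(** * Complement degrees at order p + 3 *)

Section OrderPlusThree.
Variables (p : nat) (p_gt1 : 1 < p).
Variables (T : finType) (cardT : #|T| = p.+3).
Implicit Type E : {set {set T}}.

Lemma has_book_order3 E u v S :
  has_book p E u v S <->
  exists w, [/\ u != v, w != u, w != v, S = [set~ w] &
    nonnbrs E u :|: nonnbrs E v \subset [set w]].
Proof.
split=> [[uv uS vS cS SM]|[w [uv wu wv -> Mw]]]; last first.
  by rewrite /has_book !inE cardsC1 cardT setCS ![_ == w]eq_sym.
have /cards1P[w def_w] : #|~: S| == 1.
  by have := cardsC S; rewrite cardT cS -[p.+3]addn1 => /addnI/eqP.
have def_S : S = [set~ w] by rewrite -def_w setCK.
exists w; split=> //; last by rewrite -setCS -def_S.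
  by move: uS; rewrite def_S !inE eq_sym.
by move: vS; rewrite def_S !inE eq_sym.
Qed.

(** The vertex left out of the book is the only element of the union, or any vertex off the spine
    when the union is empty. Adjacency of [u] and [v] keeps the spine out of the union. *)
Lemma card_le1_book E u v : u != v -> v \notin nonnbrs E u ->
  #|nonnbrs E u :|: nonnbrs E v| <= 1 -> exists S, has_book p E u v S.
Proof.
move=> uv vu le1.
have uU : u \notin nonnbrs E u :|: nonnbrs E v.
  by rewrite inE negb_or -nonnbrs_sym vu in_nonnbrs eqxx.
have vU : v \notin nonnbrs E u :|: nonnbrs E v.
  by rewrite inE negb_or vu in_nonnbrs eqxx.
have [M0|] := eqVneq (nonnbrs E u :|: nonnbrs E v) set0.
  have /card_gt0P[w] : 0 < #|~: [set u; v]|.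
    have := cardsC [set u; v]; rewrite cards2 uv cardT; lia.
  rewrite !inE negb_or => /andP[wu wv].
  by exists [set~ w]; apply/has_book_order3; exists w; rewrite M0 sub0set.
rewrite -card_gt0 => gt0; have /cards1P[w def_w] : #|nonnbrs E u :|: nonnbrs E v| == 1.
  by rewrite eqn_leq le1.
exists [set~ w]; apply/has_book_order3; exists w; rewrite def_w subxx.
by move: uU vU; rewrite def_w !inE ![_ == w]eq_sym; split.
Qed.

(** All p + 3 complement degrees are positive, and they cannot all be one because p + 3 is odd. So
    some [b] has degree at least two; the bound p + 4 then forces exactly two at [b] and one
    everywhere else, that is, a path [a b c] plus a matching. *)
Lemma sum_order3_shape E : ~~ odd p -> simple_graph E ->
  (forall u, nonnbrs E u != set0) -> \sum_u #|nonnbrs E u| <= p.+4 ->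
  exists a b c, [/\ uniq [:: a; b; c], nonnbrs E a = [set b],
    nonnbrs E b = [set a; c], nonnbrs E c = [set b] &
    forall x, x \notin [:: a; b; c] ->
      exists2 y, y \notin [:: a; b; c] & nonnbrs E x = [set y]].
Proof.
move=> p_even sE Mn0 le_sum.
have Mgt0 u : 0 < #|nonnbrs E u| by rewrite card_gt0.
have [/existsP[b Mb]|] := boolP [exists b, 1 < #|nonnbrs E b|]; last first.
  rewrite negb_exists => /forallP Mle1; have := odd_sum_nonnbrs sE.
  rewrite (eq_bigr (fun=> 1)) => [|u _]; first by rewrite sum1_card cardT /= p_even.
  by apply/eqP; rewrite eqn_leq leqNgt Mle1 Mgt0.
have cardA : #|[set~ b]| = p.+2 by rewrite cardsC1 cardT.
have sumD : \sum_u #|nonnbrs E u| = #|nonnbrs E b| + \sum_(u in [set~ b]) #|nonnbrs E u|.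
  by rewrite (bigD1 b) //; congr (_ + _); apply: eq_bigl => u; rewrite !inE.
have ge_sum : p.+2 <= \sum_(u in [set~ b]) #|nonnbrs E u|.
  by rewrite -cardA -sum1_card leq_sum.
have M1 u : u != b -> #|nonnbrs E u| = 1.
  move=> ub; apply: (@sum_eq_card_eq1 _ [set~ b] (fun v => #|nonnbrs E v|)) => // [|];
    rewrite ?inE //.
  by rewrite cardA; lia.
have /eqP/cards2P[a [c [ac defMb]]] : #|nonnbrs E b| = 2 by lia.
have nb z : z \in [set a; c] -> z != b /\ nonnbrs E z = [set b].
  rewrite -defMb => zb; have zb' : z != b by move: zb; rewrite in_nonnbrs => /andP[].
  split=> //; have /eqP/cards1P[y Mz] := M1 _ zb'.
  by move: zb; rewrite nonnbrs_sym Mz => /set1P->.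
have [ab Ma] := nb _ (set21 a c); have [cb Mc] := nb _ (set22 a c).
exists a, b, c; split=> //.
  by rewrite /= !inE negb_or ab ac eq_sym cb.
move=> x; rewrite !inE !negb_or => /and3P[xa xb xc].
have /eqP/cards1P[y Mx] := M1 _ xb.
have xy : x \in nonnbrs E y by rewrite nonnbrs_sym Mx set11.
exists y => //; rewrite !inE !negb_or; apply/and3P.
split; apply: contraTneq xy => ->; rewrite ?Ma ?Mb ?Mc ?defMb !inE //.
by rewrite negb_or xa.
Qed.

(** If [u] is isolated in the complement, every other vertex has complement degree at least two, and
    2(p + 2) is at least p + 6. If no vertex is isolated, a smaller sum would give the path [a b c],
    whose ends form the spine of a book avoiding [b]. *)
Lemma book_free_sum_order3 E : ~~ odd p -> simple_graph E ->
  num_copies (book p) E = 0 -> p.+3 + 3 <= \sum_u #|nonnbrs E u|.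
Proof.
move=> p_even sE free.
have M2 u v : u != v -> v \notin nonnbrs E u -> 1 < #|nonnbrs E u :|: nonnbrs E v|.
  move=> uv vu; rewrite ltnNge; apply/negP => /(card_le1_book uv vu)[S].
  exact: book_free_no_book.
have [/existsP[u /eqP Mu]|] := boolP [exists u, nonnbrs E u == set0].
  rewrite (bigD1 u) //= Mu cards0 add0n.
  apply: (@leq_trans (\sum_(v | v != u) 2)); last first.
    apply: leq_sum => v vu; rewrite -[nonnbrs E v]set0U -Mu M2 // 1?eq_sym //.
    by rewrite Mu inE.
  rewrite sum_nat_const (eq_card (B := [set~ u])) => [|v]; last by rewrite !inE.
  by rewrite cardsC1 cardT; lia.
rewrite negb_exists => /forallP Mn0; rewrite leqNgt; apply/negP => lt.
have odd_sum := odd_sum_nonnbrs sE.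
have [|a [b [c [/and3P[]]]]] := sum_order3_shape p_even sE Mn0.
  (* The sum is at most p + 5, and p + 5 is odd. *)
  move: lt odd_sum; rewrite addn3 ltnS leq_eqVlt => /orP[/eqP->|//].
  by rewrite /= !negbK (negPf p_even).
rewrite !inE negb_or => /andP[ab ac] bc _ Ma _ Mc _.
have := M2 a c ac; rewrite Ma Mc setUid cards1 inE eq_sym bc.
by move/(_ isT).
Qed.

(** It remains to exclude an isolated vertex [u] of the complement. Any [v] of complement degree at
    most one forms a spine with [u], so there is at most one such [v]. It is not isolated, since the
    omitted vertex could then be chosen in several ways. The sum would be at least 2p + 3, more than
    p + 4. *)
Lemma one_copy_order3 E : ~~ odd p -> simple_graph E ->
  \sum_u #|nonnbrs E u| = p.+4 -> num_copies (book p) E = 1 ->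
  exists a b c, [/\ uniq [:: a; b; c], nonnbrs E a = [set b],
    nonnbrs E b = [set a; c], nonnbrs E c = [set b] &
    forall x, x \notin [:: a; b; c] ->
      exists2 y, y \notin [:: a; b; c] & nonnbrs E x = [set y]].
Proof.
move=> p_even sE sumE one; apply: sum_order3_shape; rewrite ?sumE // => u.
apply/negP => /eqP Mu.
have uniq_leaf v v' : v != u -> v' != u ->
    #|nonnbrs E v| <= 1 -> #|nonnbrs E v'| <= 1 -> v = v'.
  move=> vu v'u; rewrite -[nonnbrs E v]set0U -[nonnbrs E v']set0U -Mu => c1 c1'.
  have [||//|S bk] := @card_le1_book E u v; rewrite ?Mu ?inE 1?eq_sym -?Mu //.
  have [||//|S' bk'] := @card_le1_book E u v'; rewrite ?Mu ?inE 1?eq_sym -?Mu //.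
  have [_] := one_copy_uniq p_gt1 one bk bk'.
  by rewrite !inE (negPf vu) => /eqP.
have Mn0 v : v != u -> nonnbrs E v != set0.
  move=> vu; apply/negP => /eqP Mv.
  have : 1 < #|~: [set u; v]| by have := cardsC [set u; v]; rewrite cards2 eq_sym vu cardT; lia.
  move/card_gt1P=> [w [w' []]]; rewrite !inE !negb_or.
  move=> /andP[wu wv] /andP[w'u w'v] ww'.
  have bk z : z != u -> z != v -> has_book p E u v [set~ z].
    move=> zu zv; apply/has_book_order3; exists z.
    by rewrite Mu Mv setU0 sub0set eq_sym vu.
  have [/setP/(_ w)] := one_copy_uniq p_gt1 one (bk w wu wv) (bk w' w'u w'v).
  by rewrite !inE eqxx ww'.
(* The successor makes up for the one vertex that may have degree one instead of two. *)
suff : 2 * p.+2 <= (\sum_v #|nonnbrs E v|).+1 by rewrite sumE; lia.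
have card_ne : #|[pred v | v != u]| = p.+2.
  by rewrite (eq_card (B := [set~ u])) ?cardsC1 ?cardT // => v; rewrite !inE.
rewrite (bigD1 u) //= Mu cards0 add0n mulnC -card_ne -sum_nat_const.
have [/existsP[v /andP[vu Mv]]|] := boolP [exists v, (v != u) && (#|nonnbrs E v| <= 1)].
  rewrite !(bigD1 v vu) /= -addSn leq_add //.
    by rewrite !ltnS card_gt0 Mn0.
  apply: leq_sum => v' /andP[v'u]; apply: contraNltn => Mv'.
  by rewrite (uniq_leaf v' v).
rewrite negb_exists => /forallP no; rewrite leqW // leq_sum // => v vu.
by rewrite inE in vu; rewrite ltnNge; have := no v; rewrite vu.
Qed.

End OrderPlusThree.

(** * Complete multipartite graphs as extremal examples *)

Section ClassGraph.
Variables (T : finType) (c : T -> nat).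

(** The complement is a disjoint union of cliques, one on each fibre of [c]; fibres of two and three
    vertices yield matchings and triangles. *)
Definition multipartite : {set {set T}} :=
  [set e : {set T} | (#|e| == 2) && [exists x in e, exists y in e, c x != c y]].

Lemma nonnbrs_multipartite x : nonnbrs multipartite x = [set y | (y != x) && (c y == c x)].
Proof.
apply/setP => y; rewrite !inE cards2 [x == y]eq_sym; have [//|yx] /= := eqVneq y x.
have [cyx|cyx] := eqVneq (c y) (c x).
  apply/negP => /exists_inP[x1 Hx1 /exists_inP[y1 Hy1]].
  by move: Hx1 Hy1; rewrite !inE => /orP[] /eqP-> /orP[] /eqP->; rewrite ?cyx eqxx.
apply/negbTE; rewrite negbK; apply/exists_inP; exists y; first exact: set22.
by apply/exists_inP; exists x; first exact: set21.
Qed.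

Lemma multipartite_simple : simple_graph multipartite.
Proof. by apply/forall_inP => e; rewrite inE => /andP[]. Qed.

Variables (a b : T) (ab : a != b) (cab : c a = c b).

(** The new edge lies inside a class, so it removes one edge of the complement: a matched pair
    becomes two isolated vertices, a triangle becomes a path. *)
Definition multipartite_plus : {set {set T}} := [set a; b] |: multipartite.

Lemma nonnbrs_multipartite_plus x : nonnbrs multipartite_plus x =
  [set y | [&& y != x, c y == c x &
               ~~ ((x == a) && (y == b) || (x == b) && (y == a))]].
Proof.
have pair_eq y : y != x ->
    ([set x; y] == [set a; b]) = (x == a) && (y == b) || (x == b) && (y == a).
  move=> yx; apply/eqP/orP => [eq_s|[]/andP[/eqP-> /eqP->] //]; last exact: setUC.
  have := set21 x y; have := set22 x y; rewrite eq_s !inE.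
  case/orP=> /eqP def_y /orP[] /eqP def_x; first by rewrite def_x def_y eqxx in yx.
  - by right; rewrite def_x def_y !eqxx.
  - by left; rewrite def_x def_y !eqxx.
  - by rewrite def_x def_y eqxx in yx.
apply/setP => y; rewrite in_nonnbrs in_setU1 negb_or.
have := in_nonnbrs multipartite x y; rewrite nonnbrs_multipartite !inE.
by have [//|yx /= <-] := eqVneq y x; rewrite pair_eq // andbC.
Qed.

Lemma multipartite_plus_simple : simple_graph multipartite_plus.
Proof.
apply/forall_inP => e; rewrite !inE => /orP[/eqP->|/andP[]//].
by rewrite cards2 ab.
Qed.

Lemma card_multipartite_plus : #|multipartite_plus| = #|multipartite|.+1.
Proof.
rewrite cardsU1 (_ : _ \notin _) //.
have : b \in nonnbrs multipartite a.
  by rewrite nonnbrs_multipartite inE eq_sym ab cab eqxx.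
by rewrite in_nonnbrs => /andP[].
Qed.

End ClassGraph.

(** The ends of a spine are adjacent, hence in different classes, so their nonneighbour sets are
    disjoint. Both are nonempty, so the book would have to avoid two vertices, while at most one is
    left over. *)
Lemma multipartite_book_free (p : nat) (T : finType) (c : T -> nat) :
  #|T| <= p.+3 -> (forall x, nonnbrs (multipartite c) x != set0) ->
  num_copies (book p) (multipartite c) = 0.
Proof.
move=> leT Mn0; apply: no_book_book_free => u v S [uv uS vS cS SM].
have cuv : c u != c v.
  have := subsetP SM _ vS; rewrite in_setC in_setU negb_or => /andP[+ _].
  by rewrite nonnbrs_multipartite inE [v == u]eq_sym uv /= eq_sym.
have dis : nonnbrs (multipartite c) u :&: nonnbrs (multipartite c) v = set0.
  apply/setP => w; rewrite !nonnbrs_multipartite !inE; apply/negP.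
  by move=> /andP[/andP[_ /eqP cwu] /andP[_ /eqP cwv]]; rewrite -cwu cwv eqxx in cuv.
have le1 : #|nonnbrs (multipartite c) u :|: nonnbrs (multipartite c) v| <= 1.
  have := subset_leq_card SM.
  have := cardsC (nonnbrs (multipartite c) u :|: nonnbrs (multipartite c) v).
  by rewrite cS; lia.
move: le1 (Mn0 u) (Mn0 v); rewrite cardsU dis cards0 -!card_gt0; lia.
Qed.

(** Here [d] is the least complement degree sum of a graph without copies, attained by [E2], so the
    Turán number is the size of [E2]. One further edge lowers the sum by two, which is the
    information handed to the isomorphism hypothesis; [E1] settles existence. *)
Lemma unique_graph_of_extremal (n d : nat) (U : finType) (EH : {set {set U}})
    (E1 E2 : {set {set 'I_n}}) :
  (forall E : {set {set 'I_n}}, simple_graph E -> num_copies EH E = 0 ->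
     d <= \sum_u #|nonnbrs E u|) ->
  simple_graph E2 -> num_copies EH E2 = 0 -> \sum_u #|nonnbrs E2 u| <= d ->
  simple_graph E1 -> num_copies EH E1 = 1 -> #|E1| = #|E2|.+1 ->
  (forall E E' : {set {set 'I_n}}, simple_graph E -> simple_graph E' ->
     #|E| = #|E'| -> \sum_u #|nonnbrs E u| + 2 = d ->
     num_copies EH E = 1 -> num_copies EH E' = 1 -> isomorphic E E') ->
  unique_graph_one_copy n (ex n EH + 1) EH.
Proof.
move=> ge_d sE2 free2 le_d sE1 one1 card1 iso.
have ex_eq : ex n EH = #|E2|.
  apply/eqP; rewrite eqn_leq; apply/andP; split.
    apply/bigmax_leqP => E /andP[sE /eqP /(ge_d _ sE) dE].
    have := sum_nonnbrs sE; rewrite -(sum_nonnbrs sE2) => eqs. lia.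
  by apply: (@leq_bigmax_cond _ _ (fun E : {set {set 'I_n}} => #|E|)); rewrite sE2 free2.
exists E1; split=> //; first by rewrite ex_eq addn1.
move=> E' sE' cE' one'; apply: iso => //; first by rewrite cE' ex_eq addn1.
have := ge_d _ sE2 free2; have := sum_nonnbrs sE1; have := sum_nonnbrs sE2; lia.
Qed.

(** * Existence and uniqueness at order p + 2 *)

Section UniqueOrderTwo.
Variables (p : nat) (p_gt0 : 0 < p) (p_even : ~~ odd p).

Let p_gt1 : 1 < p. Proof. lia. Qed.

(** The classes are the pairs 2i, 2i + 1; they exhaust the vertices because p + 2 is even. *)
Let c (x : 'I_p.+2) := (x : nat)./2.
Let v1 : 'I_p.+2 := inord 1.
Let partner (x : 'I_p.+2) : 'I_p.+2 := inord (if odd x then x.-1 else x.+1).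

Let val_v1 : v1 = 1 :> nat. Proof. by rewrite inordK. Qed.

Let val_partner x : partner x = (if odd x then x.-1 else x.+1) :> nat.
Proof. rewrite inordK //; have := ltn_ord x; case: ifP; lia. Qed.

Let classE x y : (y != x) && (c y == c x) = (y == partner x).
Proof. rewrite -!val_eqE /= val_partner /c; case: ifP => odd_x; apply/idP/idP; lia. Qed.

Lemma unique_graph_order2 : unique_graph_one_copy p.+2 (ex p.+2 (book p) + 1) (book p).
Proof.
have cardT : #|'I_p.+2| = p.+2 := card_ord _.
have ne01 : ord0 != v1 by rewrite -val_eqE /= val_v1.
have c01 : c ord0 = c v1 by rewrite /c val_v1.
have M2 x : nonnbrs (multipartite c) x = [set partner x].
  by rewrite nonnbrs_multipartite; apply/setP => y; rewrite !inE classE.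
have M1 x : (nonnbrs (multipartite_plus c ord0 v1) x == set0) = (x == ord0) || (x == v1).
  rewrite nonnbrs_multipartite_plus //; apply/eqP/idP => [/setP/(_ (partner x))|].
    rewrite !inE andbA classE eqxx /= => /negbFE.
    by case/orP=> /andP[->]; rewrite ?orbT.
  move=> x01; apply/setP => y; rewrite !inE andbA classE; apply/negP.
  move: x01; rewrite -!val_eqE /= val_partner val_v1; case: ifP => odd_x; lia.
have free2 : num_copies (book p) (multipartite c) = 0.
  apply: multipartite_book_free => [|x]; first by rewrite cardT.
  by rewrite M2 -cards_eq0 cards1.
apply: (unique_graph_of_extremal (d := p.+2)
  (E1 := multipartite_plus c ord0 v1) (E2 := multipartite c)).
- by move=> E; apply: book_free_sum_order2.
- exact: multipartite_simple.
- exact: free2.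
- by rewrite (eq_bigr (fun=> 1)) => [|x _]; rewrite ?M2 ?cards1 // sum1_card cardT.
- exact: multipartite_plus_simple.
- apply: (@one_copyI _ _ _ ord0 v1 setT).
    by apply/(has_book_order2 cardT); split=> //; apply/eqP; rewrite M1 eqxx ?orbT.
  move=> u v S /(has_book_order2 cardT) [uv -> /eqP + /eqP]; rewrite !M1.
  move=> /orP[] /eqP def_u /orP[] /eqP def_v; split=> //.
  - by rewrite def_u def_v eqxx in uv.
  - by left.
  - by right.
  - by rewrite def_u def_v eqxx in uv.
- exact: card_multipartite_plus.
move=> E E' sE sE' cE sumE one one'.
have sumE1 : \sum_u #|nonnbrs E u| = p by lia.
have sumE1' : \sum_u #|nonnbrs E' u| = p.
  by have := sum_nonnbrs sE; have := sum_nonnbrs sE'; lia.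
have [a [b [ab Ma Mb match_E]]] := one_copy_order2 p_gt1 cardT sumE1 one.
have [a' [b' [ab' Ma' Mb' match_E']]] := one_copy_order2 p_gt1 cardT sumE1' one'.
apply: (@isomorphic_matched _ _ _ [:: a; b] [:: a'; b']) => //; rewrite /= ?inE ?ab ?ab' //.
(* The condition on the lists is vacuous, as [a'] and [b'] have no nonneighbours. *)
by move=> x0 [|[|i]] j //= _ _; rewrite ?Ma' ?Mb' inE.
Qed.

End UniqueOrderTwo.

(** * Existence and uniqueness at order p + 3 *)

Section UniqueOrderThree.
Variables (p : nat) (p_gt0 : 0 < p) (p_even : ~~ odd p).

Let p_gt1 : 1 < p. Proof. lia. Qed.

(** The truncated predecessor puts 0 with 1 and 2, so the classes are one triple followed by the
    pairs 2i + 1, 2i + 2. *)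
Let c (x : 'I_p.+3) := (x : nat).-1./2.
Let v1 : 'I_p.+3 := inord 1.
Let v2 : 'I_p.+3 := inord 2.
(** This describes the complement of [E1], the path 0, 1, 2 plus a matching. At the middle vertex 1
    it gives only one of two nonneighbours, whence the exception in [M1]. *)
Let partner (x : 'I_p.+3) : 'I_p.+3 :=
  inord (if odd x || (x == 0 :> nat) then x.+1 else x.-1).

Let val_v1 : v1 = 1 :> nat. Proof. by rewrite inordK. Qed.
Let val_v2 : v2 = 2 :> nat. Proof. by rewrite inordK. Qed.

Let val_partner x :
  partner x = (if odd x || (x == 0 :> nat) then x.+1 else x.-1) :> nat.
Proof. rewrite inordK //; have := ltn_ord x; case: ifP; lia. Qed.

Let E1 := multipartite_plus c ord0 v2.

Let M1_v1 : nonnbrs E1 v1 = [set ord0; v2].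
Proof.
rewrite nonnbrs_multipartite_plus; apply/setP => y; rewrite !inE.
rewrite -!val_eqE /= val_v1 val_v2 /c val_v1; apply/idP/idP; lia.
Qed.

Let M1 x : x != v1 -> nonnbrs E1 x = [set partner x].
Proof.
rewrite nonnbrs_multipartite_plus => x1; apply/setP => y; rewrite !inE.
move: x1; rewrite -!val_eqE /= val_v1 val_v2 val_partner /c.
case: ifP => odd_x x1; apply/idP/idP; lia.
Qed.

Lemma unique_graph_order3 : unique_graph_one_copy p.+3 (ex p.+3 (book p) + 1) (book p).
Proof.
have cardT : #|'I_p.+3| = p.+3 := card_ord _.
have ne02 : ord0 != v2 by rewrite -val_eqE /= val_v2.
have c02 : c ord0 = c v2 by rewrite /c val_v2.
have Mn0 x : nonnbrs E1 x != set0.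
  have [->|/M1->] := eqVneq x v1; rewrite -card_gt0 ?cards1 // M1_v1.
  by rewrite cards2.
have sub12 x : nonnbrs E1 x \subset nonnbrs (multipartite c) x.
  rewrite /E1 nonnbrs_multipartite_plus nonnbrs_multipartite.
  by apply/subsetP => y; rewrite !inE => /and3P[-> ->].
have sE1 : simple_graph E1 by apply: multipartite_plus_simple.
have card1 : #|E1| = #|multipartite c|.+1 by apply: card_multipartite_plus.
have free2 : num_copies (book p) (multipartite c) = 0.
  apply: multipartite_book_free => [|x]; first by rewrite cardT.
  by apply: contraNneq (Mn0 x) => M0; rewrite -subset0 -M0 sub12.
have sum1 : \sum_u #|nonnbrs E1 u| = p.+4.
  rewrite (bigD1 v1) //= M1_v1 cards2 ne02 (eq_bigr (fun=> 1)) => [|x x1]; last first.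
    by rewrite M1 ?cards1.
  rewrite sum1_card (eq_card (B := [set~ v1])) => [|x]; last by rewrite !inE.
  by rewrite cardsC1 cardT.
have M02 x : x \in [:: ord0; v2] -> nonnbrs E1 x = [set v1].
  rewrite !inE => x02; have x1 : x != v1.
    by move: x02; rewrite -!val_eqE /= val_v1 val_v2; lia.
  rewrite M1 //; congr [set _]; apply/val_inj; rewrite /= val_partner val_v1.
  by move: x02; rewrite -!val_eqE /= val_v2 => /orP[] /eqP->.
(* The value p + 6 is the degree sum of a triangle, 6, plus that of a matching on p vertices. *)
apply: (unique_graph_of_extremal (d := p.+3 + 3) (E1 := E1) (E2 := multipartite c)).
- by move=> E; apply: book_free_sum_order3.
- exact: multipartite_simple.
- exact: free2.
- by rewrite (sum_nonnbrs_succ _ sE1 card1) ?sum1 ?addn2 ?addn3 //; apply: multipartite_simple.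
- exact: sE1.
- apply: (@one_copyI _ _ _ ord0 v2 [set~ v1]).
    apply/(has_book_order3 cardT); exists v1.
    rewrite !M02 ?inE ?eqxx ?orbT // setUid subxx -!val_eqE /= val_v1 val_v2.
    by split.
  move=> u v S /(has_book_order3 cardT) [w [uv wu wv -> Mw]].
  have vu : v \notin nonnbrs E1 u.
    apply: contraNN wv => vu; rewrite eq_sym -in_set1.
    by apply: (subsetP Mw); rewrite inE vu.
  have Mu : nonnbrs E1 u = [set w].
    apply/eqP; rewrite eqEcard cards1 card_gt0 Mn0 andbT.
    by apply: subset_trans Mw; apply: subsetUl.
  have Mv : nonnbrs E1 v = [set w].
    apply/eqP; rewrite eqEcard cards1 card_gt0 Mn0 andbT.
    by apply: subset_trans Mw; apply: subsetUr.
  have wMu : w \in nonnbrs E1 u by rewrite Mu set11.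
  have wMv : w \in nonnbrs E1 v by rewrite Mv set11.
  (* Sharing the class of [w], the vertices [u] and [v] lie in one class. Being adjacent, they are
     the ends of the added edge. *)
  move: vu wMu wMv; rewrite /E1 !nonnbrs_multipartite_plus !inE eq_sym uv /=.
  move=> + /and3P[_ /eqP cwu _] /and3P[_ /eqP cwv _].
  rewrite -cwv cwu eqxx negbK => uv02.
  have def_w : w = v1.
    apply/set1P; rewrite -(M02 u) ?Mu ?set11 // !inE.
    by case/orP: uv02 => /andP[-> _]; rewrite ?orbT.
  rewrite def_w; split=> //.
  by case/orP: uv02 => /andP[/eqP-> /eqP->]; [left|right].
- exact: card1.
move=> E E' sE sE' cE sumE one one'.
have sumE1 : \sum_u #|nonnbrs E u| = p.+4 by lia.
have sumE1' : \sum_u #|nonnbrs E' u| = p.+4.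
  by have := sum_nonnbrs sE; have := sum_nonnbrs sE'; lia.
have [a [b [x [abx Ma Mb Mx match_E]]]] := one_copy_order3 p_gt1 cardT p_even sE sumE1 one.
have [a' [b' [x' [abx' Ma' Mb' Mx' match_E']]]] :=
  one_copy_order3 p_gt1 cardT p_even sE' sumE1' one'.
apply: (@isomorphic_matched _ _ _ [:: a; b; x] [:: a'; b'; x']) => //.
move: abx'; rewrite /= !inE negb_or andbT => /andP[/andP[/negPf ab' /negPf ax'] /negPf bx'].
(* Nine pairs of positions: each is a true complement edge of the path or contradicts the
   distinctness of [a'], [b'], [x']. *)
move=> x0 [|[|[|i]]] [|[|[|j]]] //= _ _; rewrite ?Ma' ?Mb' ?Mx' ?Ma ?Mb ?Mx !inE ?eqxx ?orbT //.
all: by rewrite ?ab' ?ax' ?bx' 1?eq_sym ?ab' ?ax' ?bx' // 1?eq_sym ?ab' ?ax' ?bx'.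
Qed.

End UniqueOrderThree.

Theorem theorem2 (p : nat) (p_pos : 0 < p) (p_even : ~~ odd p) :
  unique_graph_one_copy (p + 2) (ex (p + 2) (book p) + 1) (book p) /\
  unique_graph_one_copy (p + 3) (ex (p + 3) (book p) + 1) (book p).
Proof.
by rewrite addn2 addn3; split; [apply: unique_graph_order2|apply: unique_graph_order3].
Qed.
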